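(* Let $\mathbb{F}$ be a field, $f\in\mathbb{F}[x_1,\ldots,x_n]\setminus\mathbb{F}$, and let $e\ge 2$ be an integer. The reconstruction procedure described in the context, run on input $(f,e)$, has the following property. (1) If there exists $g\in\mathbb{F}[x_1,\ldots,x_n]$ with $f=g^e$, then the procedure outputs a polynomial $\tilde g\in\mathbb{F}[x_1,\ldots,x_n]$ satisfying $\tilde g^e=f$. (2) If no such $g\in\mathbb{F}[x_1,\ldots,x_n]$ exists, then the procedure outputs ''not an $e$-th power''.
   Context: Notation: $\mathbf{x}^{\mathbf{u}}=x_1^{u_1}\cdots x_n^{u_n}$, $\langle\mathbf{u},\mathbf{k}\rangle=\sum_i u_ik_i$, $\operatorname{supp}(f)\subset\mathbb{N}^n$ is the set of exponent vectors of $f$ with nonzero coefficient, and $d=\operatorname{indeg}(f)$ is the maximum exponent of any single variable in any monomial of $f$. The reconstruction procedure on input $(f,e)$: 1. Choose $\mathbf{k}=(k_1,\ldots,k_n)\in\{1,\ldots,2d+2\}^n$ such that $\langle\mathbf{u},\mathbf{k}\rangle$ has a unique minimizer $\mathbf{a}$ over $\mathbf{u}\in\operatorname{supp}(f)$ (such $\mathbf{k}$ exists), and let $c\,\mathbf{x}^{\mathbf{a}}$ be the corresponding term of $f$. 2. Set $k_f=\langle\mathbf{a},\mathbf{k}\rangle$, $F^\sharp=y^{-k_f}f(x_1y^{k_1},\ldots,x_ny^{k_n})\in\mathbb{F}[x_1,\ldots,x_n,y]$, and $\alpha=c\,\mathbf{x}^{\mathbf{a}}$ (so $F^\sharp|_{y=0}=\alpha$).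 3. If $c$ has no $e$-th root in $\mathbb{F}$, or some coordinate of $\mathbf{a}$ is not divisible by $e$, return ''not an $e$-th power''. 4. Choose $\beta\in\mathbb{F}^*$ and $\mathbf{b}\in\mathbb{N}^n$ with $\beta^e=c$, $e\mathbf{b}=\mathbf{a}$, and set $B=\beta\mathbf{x}^{\mathbf{b}}$. 5. Form $H=\alpha^{-1}F^\sharp(x_1,\ldots,x_n,y\alpha)$, which is a polynomial in $\mathbb{F}[x_1,\ldots,x_n,y]$ with $H|_{y=0}=1$. 6. Let $p=\operatorname{char}(\mathbb{F})$. If $p>0$ and $p\mid e$, write $e=p^rq$ with $p\nmid q$. If for every term $A\,\mathbf{x}^{\mathbf{u}}y^{u_y}$ of $H$ all coordinates of $(\mathbf{u},u_y)$ are divisible by $p^r$ and $A$ has a (necessarily unique) $p^r$-th root $A^{1/p^r}$ in $\mathbb{F}$, replace $H$ by the polynomial obtained by replacing each such term by $A^{1/p^r}\mathbf{x}^{\mathbf{u}/p^r}y^{u_y/p^r}$; otherwise return ''not an $e$-th power''. If $p=0$ or $p\nmid e$, set $q=e$ and leave $H$ unchanged. 7. Let $N=\lfloor \deg_y(F^\sharp)/q\rfloor$ and let $R_0$ be the representative of $y$-degree at most $N$ of \[\sum_{i=0}^{N}\binom{1/q}{i}(H-1)^i \bmod y^{N+1}.\] Here $\binom{1/q}{i}\in\mathbb{F}$ is the image in $\mathbb{F}$ of the rational number $\frac{(1/q)(1/q-1)\cdots(1/q-i+1)}{i!}\in\mathbb{Z}[1/q]$, which is meaningful since $q$ is invertible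 in $\mathbb{F}$. 8. Form the Laurent expression $G^\sharp_{\mathrm{cand}}=B\,R_0(x_1,\ldots,x_n,y/\alpha)$. If it is not in $\mathbb{F}[x_1,\ldots,x_n,y]$, return ''not an $e$-th power''. 9. Set $g_{\mathrm{cand}}=G^\sharp_{\mathrm{cand}}(x_1,\ldots,x_n,1)$. If $g_{\mathrm{cand}}\in\mathbb{F}[x_1,\ldots,x_n]$ and $g_{\mathrm{cand}}^e=f$ (with the original input $e$), return $g_{\mathrm{cand}}$; otherwise return ''not an $e$-th power''. *)

(* Defs.v *)
From HB Require Import structures.
From mathcomp Require Import all_boot all_order all_algebra.
From mathcomp Require Import mpoly.

Set Implicit Arguments.
Unset Strict Implicit.
Unset Printing Implicit Defensive.

Import GRing.Theory.
Local Open Scope ring_scope.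

(* F[x_1..x_n, y] is represented as {poly {mpoly F[n]}}, the variable y being
   the outer 'X. Expressions with negative powers of a monomial of
   F[x_1..x_n] live in {poly {fraction {mpoly F[n]}}}, where the polynomials
   of F[x_1..x_n, y] are the image of the injection [to_laurent] below. *)

Definition mdot n (u : 'X_{1..n}) (k : 'I_n -> nat) : nat :=
  (\sum_(i < n) u i * k i)%N.

Definition indeg n (F : fieldType) (f : {mpoly F[n]}) : nat :=
  (\max_(u <- msupp f) \max_(i < n) u i)%N.

Definition gbinom (x : rat) (i : nat) : rat :=
  (\prod_(j < i) (x - j%:R)) / (i`!)%:R.

(* The nondeterministic choices of the procedure. The exponent [ch_a] is
   determined by the weight vector [ch_k]. *)
Record choices (F : fieldType) (n : nat) := Choices {
  ch_k : 'I_n -> nat;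
  ch_a : 'X_{1..n};
  ch_beta : F;
  ch_b : 'X_{1..n}
}.

Section Procedure.

Variables (F : fieldType) (n : nat).
Implicit Types (f g : {mpoly F[n]}) (a b u : 'X_{1..n}) (e p q r m : nat).
Implicit Types (k : 'I_n -> nat) (c beta : F).

Local Notation A := {mpoly F[n]}.
Local Notation Frac := {fraction {mpoly F[n]}}.

Definition to_laurent (P : {poly A}) : {poly Frac} :=
  map_poly (@tofrac A) P.

Definition weight_choice f k a : Prop :=
  [/\ forall i, (1 <= k i <= 2 * indeg f + 2)%N,
      a \in msupp f
    & forall u, u \in msupp f -> u != a -> (mdot a k < mdot u k)%N].

Definition has_eth_root c e : Prop := exists beta, beta ^+ e = c.

Definition leading_test f e a : Prop :=
  has_eth_root f@_a e /\ forall i, (e %| a i)%N.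

Definition root_choice f e a beta b : Prop :=
  [/\ beta != 0, beta ^+ e = f@_a & forall i, (e * b i)%N = a i].

(* [ch_beta] and [ch_b] are unconstrained when the procedure stops before
   using them. *)
Definition admissible f e (s : choices F n) : Prop :=
  weight_choice f (ch_k s) (ch_a s) /\
  (leading_test f e (ch_a s) -> root_choice f e (ch_a s) (ch_beta s) (ch_b s)).

(* f (x_1 y^k_1, ..., x_n y^k_n) *)
Definition weight_subst f k : {poly A} :=
  mmap (fun c => (c%:MP_[n])%:P) (fun i => ('X_i : A)%:P * 'X^(k i)) f.

(* Fs = y^(- <a, k>) f (x_1 y^k_1, ..., x_n y^k_n) *)
Definition is_Fsharp f k a (Fs : {poly A}) : Prop :=
  'X^(mdot a k) * Fs = weight_subst f k.

Definition lead_term f a : A := f@_a *: 'X_[a].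

(* H = alpha^-1 Fs (x_1, ..., x_n, y alpha) *)
Definition is_H (alpha : A) (Fs H : {poly A}) : Prop :=
  to_laurent H =
    (tofrac alpha)^-1 *: (to_laurent Fs \Po (tofrac alpha *: 'X)).

Definition term_test m (H : {poly A}) : Prop :=
  forall (j : nat) u, u \in msupp H`_j ->
    [/\ (m %| j)%N, forall i, (m %| u i)%N & has_eth_root (H`_j)@_u m].

Definition mnm_div u m : 'X_{1..n} := [multinom (u i %/ m)%N | i < n].

Definition term_root m (rt : F -> F) (H : {poly A}) : {poly A} :=
  \sum_(j < size H)
    (\sum_(u <- msupp H`_j) rt (H`_j)@_u *: ('X_[mnm_div u m] : A))
      *: 'X^(j %/ m).

(* [Some (q, H')] gives the exponent q and the new value H' of H, [None] is
   the answer "not an e-th power". *)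
Inductive frobenius_step e (H : {poly A}) : option (nat * {poly A}) -> Prop :=
| Frobenius_skip of (forall p, p \in [pchar F] -> ~~ (p %| e)%N) :
    frobenius_step e H (Some (e, H))
| Frobenius_root p r q (rt : F -> F) of
    p \in [pchar F] & (p %| e)%N & e = (p ^ r * q)%N & ~~ (p %| q)%N &
    term_test (p ^ r) H &
    (forall (j : nat) u, u \in msupp H`_j ->
       rt (H`_j)@_u ^+ (p ^ r) = (H`_j)@_u) :
    frobenius_step e H (Some (q, term_root (p ^ r) rt H))
| Frobenius_fail p r q of
    p \in [pchar F] & (p %| e)%N & e = (p ^ r * q)%N & ~~ (p %| q)%N &
    ~ term_test (p ^ r) H :
    frobenius_step e H None.

(* [root_series] is used with q invertible in F. Since gbinom q^-1 i lies in
   Z[1/q], its reduced denominator divides a power of q, so [ratr] computes its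
   image under Z[1/q] -> F, also in positive characteristic. *)
Definition root_series q (Fs H : {poly A}) : {poly A} :=
  let N := ((size Fs).-1 %/ q)%N in
  take_poly N.+1
    (\sum_(i < N.+1)
       (ratr (gbinom (q%:R)^-1 i) : F)%:MP_[n] *: (H - 1) ^+ i).

(* B R0 (x_1, ..., x_n, y / alpha) *)
Definition laurent_candidate (alpha B : A) (R0 : {poly A}) : {poly Frac} :=
  tofrac B *: (to_laurent R0 \Po ((tofrac alpha)^-1 *: 'X)).

Definition is_polynomial (L : {poly Frac}) : Prop :=
  exists G : {poly A}, to_laurent G = L.

(* With the choices s, the procedure gets as far as forming Fs and H. *)
Definition reach_H f e (s : choices F n) (Fs H : {poly A}) : Prop :=
  [/\ leading_test f e (ch_a s),
      is_Fsharp f (ch_k s) (ch_a s) Fs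
    & is_H (lead_term f (ch_a s)) Fs H].

(* With the choices s, the procedure gets as far as the Laurent expression L. *)
Definition reach_candidate f e (s : choices F n) (L : {poly Frac}) : Prop :=
  exists Fs H q H',
    [/\ reach_H f e s Fs H,
        frobenius_step e H (Some (q, H'))
      & L = laurent_candidate (lead_term f (ch_a s))
              (ch_beta s *: 'X_[ch_b s]) (root_series q Fs H')].

(* [None] is the answer "not an e-th power". *)
Inductive outputs f e (s : choices F n) : option A -> Prop :=
| Stop_leading of ~ leading_test f e (ch_a s) : outputs f e s None
| Stop_frobenius Fs H of
    reach_H f e s Fs H & frobenius_step e H None : outputs f e s None
| Stop_laurent L of
    reach_candidate f e s L & ~ is_polynomial L : outputs f e s None
| Stop_power L of
    reach_candidate f e s L & is_polynomial L &
    ~ (exists g, tofrac g = L.[1] /\ g ^+ e = f) : outputs f e s None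
| Return L g of
    reach_candidate f e s L & is_polynomial L &
    tofrac g = L.[1] & g ^+ e = f : outputs f e s (Some g).

End Procedure.

(* Main.v *)
Require Import Defs.
From Stdlib Require Import Classical ClassicalEpsilon.
From mathcomp Require Import all_boot all_order all_algebra.
From mathcomp Require Import mpoly zify ring.

(* If [f = g ^+ e], the substitution x_i -> x_i y^k_i turns [g] into [y^m G]
   with [G ^+ e = F#], and [G] at [y = 0] is an [e]-th root of the monomial
   [alpha], hence itself a monomial, equal to [B] after rescaling [G] by an
   [e]-th root of unity. Then [R = B^-1 G(x, y alpha)] is a polynomial with
   constant term 1 and [R ^+ e = H]. The Frobenius step replaces [H] by
   [R ^+ q], because the Frobenius map is injective, and the binomial series
   recovers [R], because a [q]-th root with constant term 1 is unique modulo
   y^(N+1). Undoing the substitutions gives back [G]. The remaining assertions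
   hold because every step is deterministic and the last step tests
   [g_cand ^+ e = f]. *)

Set Implicit Arguments.
Unset Strict Implicit.
Unset Printing Implicit Defensive.
Import GRing.Theory Num.Theory.

Local Open Scope ring_scope.

(** * Binomial series of (1 + z)^(1/q) *)

(** First order Taylor expansion with quadratic remainder, for the Newton correction below. *)
Lemma exprD_quad (R : comNzRingType) (x d : R) m :
  exists Y, (x + d) ^+ m.+1 = x ^+ m.+1 + (m.+1)%:R * x ^+ m * d + d ^+ 2 * Y.
Proof.
elim: m => [|m [Y eY]]; first by exists 0; rewrite !expr1 expr0; ring.
exists ((x + d) * Y + (m.+1)%:R * x ^+ m).
by rewrite exprS eY [x ^+ m.+2]exprS exprS -[m.+2]addn1 natrD; ring.
Qed.

Lemma coef0_divX (R : nzRingType) (P : {poly R}) :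
  exists Z, P = (P`_0)%:P + 'X * Z.
Proof.
exists (drop_poly 1 P); apply/polyP => -[|i].
  by rewrite coefD coefC coefXM addr0.
by rewrite coefD coefC coefXM add0r coef_drop_poly addn1.
Qed.

Lemma coef0_exp (R : nzRingType) (P : {poly R}) m : (P ^+ m)`_0 = P`_0 ^+ m.
Proof. by elim: m => [|m IH]; rewrite ?expr0 ?coefC // !exprS coef0M IH. Qed.

(* The substitution z -> q^2 z clears the denominators of (1 + z)^(1/q). *)
Lemma int_root_exists q N :
  exists T V : {poly int},
    [/\ T`_0 = 1, (size T <= N.+1)%N
      & T ^+ q.+1 = 1 + (q.+1%:R ^+ 2) * ('X + 'X^(N.+1) * V)].
Proof.
elim: N => [|N [T [V [T0 sT eT]]]].
  by exists 1, (-1); rewrite coefC size_poly1; split=> //; rewrite expr1n; ring.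
have [V' eV] := coef0_divX V.
have [Z eZ] := coef0_divX (T ^+ q).
have {}eZ : T ^+ q = 1 + 'X * Z by rewrite eZ coef0_exp T0 expr1n.
set v := (V`_0)%:P in eV.
have [Y eY] := exprD_quad T (- (q.+1%:R * v * 'X^(N.+1))) q.
(* Newton correction: as [T ^+ q] is 1 modulo ['X], the linear term of the expansion cancels the
   lowest coefficient [v] of the error. The second witness collects what remains after division by
   ['X^(N.+2)]. *)
exists (T - q.+1%:R * v * 'X^(N.+1)), (V' - v * Z + v ^+ 2 * 'X^N * Y); split.
- by rewrite coefB coefMXn /= T0 subr0.
- rewrite (leq_trans (size_polyD _ _)) // geq_max (leq_trans sT) //= size_polyN.
  rewrite -polyC_natr -polyCM mul_polyC (leq_trans (size_scale_leq _ _)) //.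
  by rewrite size_polyXn.
- by rewrite eY eT eZ eV !exprS; ring.
Qed.

Lemma gbinomS x i : gbinom x i.+1 * i.+1%:R = gbinom x i * (x - i%:R).
Proof.
have i0 (j : nat) : (j`!)%:R != 0 :> rat by rewrite pnatr_eq0 -lt0n fact_gt0.
rewrite /gbinom big_ord_recr /= factS natrM invfM.
by field; rewrite i0 -[1 + _]/(1%:R + _) -natrD pnatr_eq0.
Qed.

(* Differentiating the equation of [T] gives a first order differential equation,
   whose coefficient recurrence is that of the binomial coefficients. *)
Lemma int_root_coef q N (T V : {poly int}) :
  T`_0 = 1 -> T ^+ q.+1 = 1 + (q.+1%:R ^+ 2) * ('X + 'X^(N.+1) * V) ->
  forall i, (i <= N)%N ->
    (T`_i)%:~R = (q.+1%:R ^+ 2) ^+ i * gbinom (q.+1%:R)^-1 i.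
Proof.
move=> T0 eT.
have [W eW] : exists W, (1 + (q.+1%:R ^+ 2) * ('X + 'X^(N.+1) * V))^`()
    = q.+1%:R ^+ 2 * (1 + 'X^N * W).
  exists (N.+1%:R * V + 'X * V^`()); rewrite -polyC_natr -polyC_exp !derivE.
  by rewrite -(mulr_natl _ N.+1) /= (exprS 'X); ring.
pose Q : int := q.+1%:R.
have eQ : q.+1%:R = Q%:P by rewrite -polyC_natr.
(* Up to the factor [Q], cancelled coefficientwise in [rec], this is (1 + Q^2 X) T' = Q T modulo
   X^N, the equation satisfied by (1 + Q^2 X)^(1/Q). *)
have [W2 ode] : exists W2,
    Q%:P * (T^`() * (1 + Q%:P ^+ 2 * 'X) - Q%:P * T) = 'X^N * W2.
  exists (Q%:P ^+ 2 * T * W - Q%:P ^+ 3 * T^`() * 'X * V).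
  have := congr1 (fun P : {poly int} => T * P^`()) eT.
  rewrite eW deriv_exp mulrnAr mulrCA -exprS eT -(mulr_natl _ q.+1) eQ => e1.
  have -> : Q%:P * (T^`() * (1 + Q%:P ^+ 2 * 'X) - Q%:P * T) =
     Q%:P * (T^`() * (1 + Q%:P ^+ 2 * ('X + 'X^(N.+1) * V)))
     - Q%:P ^+ 3 * T^`() * 'X^(N.+1) * V - Q%:P ^+ 2 * T by ring.
  by rewrite e1 (exprS 'X); ring.
have rec i : (i < N)%N -> T`_i.+1 * i.+1%:R = (Q - Q ^+ 2 * i%:R) * T`_i.
  move=> iN; have := congr1 (fun P : {poly int} => P`_i) ode.
  rewrite coefXnM iN coefCM => /eqP; rewrite mulf_eq0 pnatr_eq0 /=.
  rewrite coefB coefCM mulrDr mulr1 mulrA coefD coefMX coef_deriv -polyC_exp.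
  rewrite coefMC coef_deriv => /eqP; case: i {iN} => [|i] /= e.
    by move/eqP: e; rewrite addr0 subr_eq0 => /eqP; rewrite mulr1n => ->; ring.
  move/eqP: e; rewrite subr_eq0 => /eqP e.
  rewrite mulr_natr mulrBl -e -(mulr_natr _ i.+1); ring.
have Q0 : Q%:~R != 0 :> rat by rewrite intr_eq0 pnatr_eq0.
elim=> [|i IH] iN.
  by rewrite T0 expr0 mul1r /gbinom big_ord0 fact0 divr1.
have i0 : i.+1%:R != 0 :> rat by rewrite pnatr_eq0.
apply: (mulIf i0); rewrite -mulrA gbinomS mulrA.
have := congr1 (fun z : int => z%:~R : rat) (rec i iN).
rewrite !rmorphM rmorphB rmorphM rmorphXn /= !natz => ->.
rewrite IH ?(ltnW iN) // [_ ^+ i.+1]exprS.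
have -> : Q%:~R = q.+1%:R :> rat by rewrite /Q natz -pmulrn.
rewrite -!pmulrn; set g := gbinom _ _; set x := q.+1%:R; set y := _ ^+ i.
have x0 : x != 0 by rewrite pnatr_eq0.
by clearbody x; field.
Qed.

(** [ratr] uses the reduced denominator. It divides [d], so it stays nonzero in [F] even in positive
    characteristic. *)
Lemma ratr_frac (F : fieldType) (m d : int) :
  d%:~R != 0 :> F -> ratr (m%:~R / d%:~R) = m%:~R / d%:~R :> F.
Proof.
move=> d0; set x := _ / _.
have dn0 : d != 0 by apply: contraNneq d0 => ->; rewrite rmorph0.
have dq0 : d%:~R != 0 :> rat by rewrite intr_eq0.
have ex : m * denq x = numq x * d.
  apply: (@intr_inj rat); rewrite !rmorphM /= numqE.
  by rewrite /x mulrAC divfK.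
have [c ec] : exists c, d = c * denq x.
  apply/dvdzP; rewrite -(@Gauss_dvdzr _ (numq x)) -?ex ?dvdz_mull //.
  by rewrite coprimez_sym coprimezE coprime_num_den.
have den0 : (denq x)%:~R != 0 :> F.
  by apply: contraNneq d0 => e; rewrite ec rmorphM /= e mulr0.
rewrite /ratr; apply/eqP; rewrite eqr_div // -!rmorphM /=.
by rewrite -ex mulrC.
Qed.

Section BinomialSeries.

Variables (F : fieldType) (L : comNzRingType) (phi : {rmorphism F -> L}).

(** The integral polynomial [T] is evaluated at w / q^2, which makes sense because q is invertible
    in [F]. This undoes the rescaling that cleared the denominators. *)
Lemma binomial_series_root q N (w : L) : q%:R != 0 :> F ->
  exists V, (\sum_(i < N.+1) phi (ratr (gbinom (q%:R)^-1 i)) * w ^+ i) ^+ q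
     = 1 + w + w ^+ N.+1 * V.
Proof.
case: q => [|q]; first by rewrite eqxx.
move=> q0; have [T [V [T0 sT eT]]] := int_root_exists q N.
have cT := int_root_coef T0 eT.
set Q : F := q.+1%:R in q0; pose z : L := phi (Q ^- 2) * w.
have eQz : (q.+1%:R ^+ 2) * z = w.
  rewrite -(rmorph_nat phi) -rmorphXn mulrA -rmorphM divff ?expf_neq0 //.
  by rewrite rmorph1 mul1r.
pose ev : {rmorphism {poly int} -> L} := horner_eval z \o map_poly intr.
have evX : ev 'X = z by rewrite /= map_polyX /horner_eval hornerX.
have -> : \sum_(i < N.+1) phi (ratr (gbinom (q.+1%:R)^-1 i)) * w ^+ i = ev T.
  rewrite -[T in ev T](poly_take_drop N.+1) drop_poly_eq0 // mul0r addr0.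
  rewrite take_poly_id // /= /horner_eval.
  rewrite (@horner_coef_wide _ N.+1); last first.
    exact: leq_trans (size_poly _ _) sT.
  apply: eq_bigr => i _; rewrite coef_map /=.
  have -> : gbinom q.+1%:R^-1 i = (T`_i)%:~R / ((q.+1%:Z ^+ 2) ^+ i)%:~R :> rat.
    rewrite cT -1?ltnS // !rmorphXn /= -pmulrn mulrC mulKf //.
    by rewrite !expf_neq0 // pnatr_eq0.
  have Qi : ((q.+1%:Z ^+ 2) ^+ i)%:~R = Q ^+ 2 ^+ i :> F.
    by rewrite !rmorphXn /= -pmulrn.
  rewrite ratr_frac; last by rewrite Qi !expf_neq0.
  rewrite Qi rmorphM rmorph_int -mulrA; congr (_ * _).
  by rewrite -(exprVn (Q ^+ 2)) rmorphXn -exprMn.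
exists (q.+1%:R ^+ 2 * phi (Q ^- 2) ^+ N.+1 * ev V).
rewrite -rmorphXn eT rmorphD rmorph1 rmorphM rmorphXn rmorph_nat.
rewrite rmorphD rmorphM rmorphXn evX mulrDr eQz addrA; congr (_ + _).
by rewrite /z exprMn; ring.
Qed.

End BinomialSeries.

(** * Uniqueness of q-th roots modulo powers of the variable *)

Lemma mul_eqXn_divXn (R : idomainType) M (D E V : {poly R}) :
  E`_0 != 0 -> D * E = 'X^M * V -> exists D', D = 'X^M * D'.
Proof.
move=> E0; elim: M D V => [|M IH] D V eDE; first by exists D; rewrite mul1r.
have D0 : D`_0 = 0.
  have := congr1 (fun P : {poly R} => P`_0) eDE.
  rewrite coef0M coefXnM /= => /eqP; rewrite mulf_eq0 (negbTE E0) orbF.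
  by move=> /eqP.
have [D1 eD] := coef0_divX D; rewrite D0 add0r in eD.
have [|D' eD'] := IH D1 V.
  by apply: (mulfI (monic_neq0 (monicX R))); rewrite mulrA -eD eDE exprS mulrA.
by exists D'; rewrite eD eD' exprS mulrA.
Qed.

(** In the factorization of P^q - S^q by P - S, the cofactor has constant term q, which is nonzero;
    hence X^M divides P - S. *)
Lemma eq_root_modXn (R : idomainType) M q (P S V : {poly R}) :
  q%:R != 0 :> R -> P`_0 = 1 -> S`_0 = 1 -> P ^+ q = S ^+ q + 'X^M * V ->
  take_poly M P = take_poly M S.
Proof.
move=> q0 P0 S0 e.
have [||D eD] := @mul_eqXn_divXn R M (P - S)
   (\sum_(i < q) P ^+ (q.-1 - i) * S ^+ i) V.
- rewrite coef_sum (eq_bigr (fun=> 1)) ?sumr_const ?card_ord //.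
  by move=> i _; rewrite coef0M !coef0_exp P0 S0 !expr1n mulr1.
- by rewrite -subrXX e addrC addKr.
by rewrite -[P](subrK S) eD take_polyD mulrC take_polyMXn_0 add0r.
Qed.

Section RootSeries.
Variables (F : fieldType) (n : nat).
Local Notation A := {mpoly F[n]}.

Lemma root_series_exact q (Fs R : {poly A}) :
  q%:R != 0 :> F -> R`_0 = 1 ->
  (size R <= ((size Fs).-1 %/ q).+1)%N ->
  root_series q Fs (R ^+ q) = R.
Proof.
move=> q0 R0; rewrite /root_series; set N := (_ %/ q)%N => sR.
pose phi : {rmorphism F -> {poly A}} := polyC \o (@mpolyC n F).
have [V] := binomial_series_root phi N (R ^+ q - 1) q0.
(* Divisibility by y turns the error term of the binomial series, a multiple of the (N+1)-st power
   of R^q - 1, into a multiple of y^(N+1). *)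
have [Z eZ] : exists Z, R ^+ q - 1 = 'X * Z.
  have [Z eZ] := coef0_divX (R ^+ q); exists Z.
  by rewrite eZ coef0_exp R0 expr1n addrAC subrr add0r.
set S := \sum_(i < _) _ => eS.
have -> : \sum_(i < N.+1) (ratr (gbinom q%:R^-1 i) : F)%:MP_[n]
   *: (R ^+ q - 1) ^+ i = S by apply: eq_bigr => i _; rewrite -mul_polyC.
rewrite -[RHS](take_poly_id sR).
apply: (@eq_root_modXn _ N.+1 q S R (Z ^+ N.+1 * V)) => //.
- by rewrite -(rmorph_nat (@mpolyC n F)) mpolyC_eq0.
- rewrite /S big_ord_recl /= coefD expr0 mulr1 coefC /=.
  have -> : ratr (gbinom q%:R^-1 0) = 1 :> F.
    by rewrite /gbinom big_ord0 fact0 divr1 (ratr_nat F 1).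
  rewrite mpolyC1 coef_sum big1 ?addr0 //.
  by move=> i _; rewrite eZ exprMn exprS -mulrA coefCM coefXM mulr0.
by rewrite eS {2}eZ exprMn mulrA [1 + _]addrC subrK.
Qed.

End RootSeries.

(** * Roots of order a power of the characteristic *)

Section Frobenius.
Variables (F : fieldType) (n p r : nat).
Hypothesis (pF : p \in [pchar F]).
Local Notation A := {mpoly F[n]}.
Local Notation m := (p ^ r)%N.

Section ExprSum.
Variables (R : comNzRingType) (phi : {rmorphism F -> R}).

Let m_nat : [pchar R].-nat m.
Proof.
by rewrite pnatX pnatE ?(pcharf_prime pF) // (rmorph_pchar phi pF).
Qed.

Lemma expr_pchar_sum I (s : seq I) (x : I -> R) :
  (\sum_(i <- s) x i) ^+ m = \sum_(i <- s) x i ^+ m.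
Proof.
elim/big_rec2: _ => [|i y z _ <-]; last by rewrite exprDn_pchar.
by rewrite expr0n expn_eq0 eqn0Ngt prime_gt0 ?(pcharf_prime pF).
Qed.

Lemma exprD_pchar (x y : R) : (x + y) ^+ m = x ^+ m + y ^+ m.
Proof. exact: exprDn_pchar. Qed.
End ExprSum.


Lemma expr_pchar_gt0 : (0 < m)%N.
Proof. by rewrite expn_gt0 prime_gt0 ?(pcharf_prime pF). Qed.

(** Additivity of the Frobenius map gives (x - y)^m = 0. The morphism [phi] only transports the
    characteristic from [F] to [R]. *)
Lemma expr_pchar_inj (R : idomainType) (phi : {rmorphism F -> R}) :
  injective (fun x : R => x ^+ m).
Proof.
move=> x y /= e; apply/eqP; rewrite -subr_eq0.
have /eqP := exprD_pchar phi (x - y) y.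
by rewrite subrK e -subr_eq addrN eq_sym expf_eq0 => /andP[].
Qed.

Let phi : {rmorphism F -> {poly A}} := polyC \o (@mpolyC n F).

Lemma term_expansion (H : {poly A}) :
  H = \sum_(j < size H) \sum_(u <- msupp H`_j)
        ((H`_j)@_u *: 'X_[u] : A) *: 'X^j.
Proof.
rewrite -[LHS]coefK poly_def; apply: eq_bigr => j _.
by rewrite -scaler_suml -mpolyE.
Qed.

Lemma term_root_pow (rt : F -> F) (H : {poly A}) :
  term_test m H ->
  (forall (j : nat) u, u \in msupp H`_j ->
       rt (H`_j)@_u ^+ m = (H`_j)@_u) ->
  term_root m rt H ^+ m = H.
Proof.
move=> tH rtH; rewrite /term_root (expr_pchar_sum phi) [RHS]term_expansion.
apply: eq_bigr => j _; rewrite scaler_suml (expr_pchar_sum phi).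
rewrite big_seq [RHS]big_seq; apply: eq_bigr => u uH.
have [mj mu _] := tH _ _ uH.
rewrite exprZn exprZn rtH // -exprM divnK // mpolyXn; congr (_ *: 'X_[_] *: _).
by apply/mnmP => i; rewrite mulmnE mnmE divnK.
Qed.

(** All coefficients of [H] and [K], zero included, have m-th roots, and the sum of two such roots
    is a root of the sum of the coefficients. *)
Lemma term_testD (H K : {poly A}) :
  term_test m H -> term_test m K -> term_test m (H + K).
Proof.
have rt (L : {poly A}) j u : term_test m L -> has_eth_root (L`_j)@_u m.
  have [uL /(_ _ _ uL)[]//|uL _] := boolP (u \in msupp L`_j).
  by exists 0; rewrite (memN_msupp_eq0 uL) expr0n eqn0Ngt expr_pchar_gt0.
move=> tH tK j u; rewrite mcoeff_msupp coefD mcoeffD => nz.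
have [mj mu] : (m %| j)%N /\ forall i, (m %| u i)%N.
  have [/tH[]//|] := boolP (u \in msupp H`_j).
  have [/tK[]//|uK uH] := boolP (u \in msupp K`_j).
  by case/eqP: nz; rewrite !memN_msupp_eq0 ?addr0.
split=> //; have [b1 e1] := rt _ j u tH; have [b2 e2] := rt _ j u tK.
by exists (b1 + b2); rewrite (exprD_pchar (idfun : {rmorphism F -> F})) e1 e2.
Qed.

(** By additivity of the Frobenius map, [S ^+ m] is the sum of the m-th powers of the terms of
    [S]. *)
Lemma term_test_exp (S : {poly A}) : term_test m (S ^+ m).
Proof.
have t0 : term_test m (0 : {poly A}) by move=> j u; rewrite coef0 msupp0.
rewrite (term_expansion S) (expr_pchar_sum phi).
elim/big_ind: _ => [||j _] //; first exact: term_testD.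
rewrite (expr_pchar_sum phi).
elim/big_ind: _ => [||u _] //; first exact: term_testD.
rewrite exprZn exprZn -exprM mpolyXn => i v.
rewrite mcoeff_msupp coefZ coefXn mulr_natr mcoeffMn mcoeffZ mcoeffX.
case: (i =P _) => [->|_]; last by rewrite mulr0n eqxx.
case: (_ =P v) => [<-|_]; last by rewrite mulr0 mul0rn eqxx.
rewrite mulr1 mulr1n => _; split; first exact: dvdn_mull.
  by move=> k; rewrite mulmnE dvdn_mull.
by exists (S`_j)@_u.
Qed.

Lemma term_root_exp (rt : F -> F) (S : {poly A}) :
  (forall (j : nat) u, u \in msupp (S ^+ m)`_j ->
       rt ((S ^+ m)`_j)@_u ^+ m = ((S ^+ m)`_j)@_u) ->
  term_root m rt (S ^+ m) = S.
Proof.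
move=> rtS; apply: (expr_pchar_inj phi) => /=.
by apply: term_root_pow => //; exact: term_test_exp.
Qed.

End Frobenius.

(** * Weights, leading terms and Laurent expressions *)

Lemma factor_polyXn (R : nzRingType) (P : {poly R}) :
  P != 0 -> exists m Q, P = 'X^m * Q /\ Q`_0 != 0.
Proof.
move=> P0; have exP : exists i, P`_i != 0.
  by exists (size P).-1; rewrite -lead_coefE lead_coef_eq0.
case: (ex_minnP exP) => m Pm min; exists m, (drop_poly m P).
rewrite coef_drop_poly add0n; split=> //; apply/polyP => i.
rewrite coefXnM coef_drop_poly; case: ltnP => im; last by rewrite subnK.
by apply/eqP; apply: contraLR im => /min; rewrite -leqNgt.
Qed.

(** Write P = X^l Q with Q(0) nonzero. Comparing lowest exponents gives l e = s, so Q^e is constant,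
    and so is Q. *)
Lemma polyXn_root (R : idomainType) (P : {poly R}) c s e :
  (0 < e)%N -> c != 0 -> P ^+ e = c *: 'X^s -> exists b l, P = b *: 'X^l.
Proof.
move=> e0 c0 eP; have P0 : P != 0.
  apply/eqP => P0; move/eqP: eP.
  rewrite P0 expr0n eqn0Ngt e0 eq_sym -mul_polyC mulf_eq0 polyC_eq0.
  by rewrite (negbTE c0) (negbTE (monic_neq0 (monicXn _ _))).
have [l [Q [eQ Q0]]] := factor_polyXn P0.
have Qnz : Q != 0 by apply: contraNneq Q0 => ->; rewrite coef0.
move: eP; rewrite eQ exprMn -exprM => eP.
have els : (l * e = s)%N.
  have := congr1 (fun P : {poly R} => P`_(l * e)) eP.
  rewrite coefXnM ltnn subnn coef0_exp coefZ coefXn.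
  case: eqP => // _ /eqP; rewrite mulr0 expf_eq0 (negbTE Q0) andbF //.
have sQ : (size Q).-1 = 0%N.
  move: eP; rewrite -els -mul_polyC mulrC.
  move=> /(mulIf (monic_neq0 (monicXn _ _))).
  move=> /(congr1 (fun P : {poly R} => (size P).-1)).
  rewrite size_exp size_polyC c0 => /eqP; rewrite muln_eq0 (gtn_eqF e0) orbF.
  by move/eqP.
have : (size Q <= 1)%N by rewrite -subn_eq0 subn1 sQ.
by move/size1_polyC => ->; exists Q`_0, l; rewrite mulrC mul_polyC.
Qed.

Lemma coef_comp_polyZX (R : comNzRingType) (P : {poly R}) x j :
  (P \Po (x *: 'X))`_j = P`_j * x ^+ j.
Proof.
rewrite comp_polyE (eq_bigr (fun i : 'I__ => (P`_i * x ^+ i) *: 'X^i)).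
  rewrite -(poly_def _ (fun i => P`_i * x ^+ i)) coef_poly.
  case: ltnP => // /(nth_default 0) ->.
  by rewrite mul0r.
by move=> i _; rewrite exprZn scalerA.
Qed.

(** * The weight substitution and its lowest term in y *)

Section WeightSubst.
Variables (F : fieldType) (n : nat).
Local Notation A := {mpoly F[n]}.
Implicit Types (f h : A) (k : 'I_n -> nat).

Lemma weight_substE f k :
  weight_subst f k =
    \sum_(u <- msupp f) (f@_u *: 'X_[u] : A) *: 'X^(mdot u k).
Proof.
rewrite /weight_subst /mmap; apply: eq_bigr => u _.
rewrite /mmap1 (eq_bigr (fun i => ('X_i ^+ u i : A)%:P * 'X^(u i * k i))).
  rewrite big_split /= -rmorph_prod -mpolyXE_id prodrXr -mul_polyC mulrA.
  by rewrite -polyCM mul_mpolyC.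
by move=> i _; rewrite exprMn -polyC_exp -exprM mulnC.
Qed.

Lemma coef_weight_subst f k j v :
  (weight_subst f k)`_j@_v = f@_v *+ (mdot v k == j).
Proof.
rewrite weight_substE coef_sum raddf_sum /=.
rewrite (eq_bigr (fun u => f@_u * (u == v)%:R *+ (mdot u k == j))); last first.
  move=> u _; rewrite coefZ coefXn mulr_natr mcoeffMn mcoeffZ mcoeffX.
  by rewrite (eq_sym j).
have [vf|vf] := boolP (v \in msupp f); last first.
  rewrite (memN_msupp_eq0 vf) mul0rn big_seq big1 // => u uf.
  by case: eqP => [uv|_]; [rewrite -uv uf in vf | rewrite mulr0 mul0rn].
rewrite (bigD1_seq v) ?msupp_uniq //= eqxx mulr1 big1 ?addr0 // => u /negbTE ->.
by rewrite mulr0 mul0rn.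
Qed.

Lemma weight_substXn f k m : weight_subst (f ^+ m) k = weight_subst f k ^+ m.
Proof. exact: (rmorphXn (mmap (polyC \o @mpolyC n F) _)). Qed.

Lemma weight_subst_at1 f k : (weight_subst f k).[1] = f.
Proof.
rewrite weight_substE horner_sum [RHS]mpolyE; apply: eq_bigr => u _.
by rewrite hornerZ hornerXn expr1n mulr1.
Qed.

Lemma mpolyZX_neq0 c a : c != 0 -> c *: 'X_[a] != 0 :> A.
Proof.
apply: contra_neq => /(congr1 (mcoeff a)).
by rewrite mcoeff0 mcoeffZ mcoeffX eqxx mulr1.
Qed.

Lemma weight_subst_term c a k :
  weight_subst (c *: 'X_[a]) k = (c *: 'X_[a] : A) *: 'X^(mdot a k).
Proof.
apply/polyP => j; apply/mpolyP => v; rewrite coef_weight_subst coefZ coefXn.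
rewrite mulr_natr mcoeffMn !mcoeffZ mcoeffX (eq_sym j).
by case: (a =P v) => [->|]; rewrite ?mulr0 ?mul0rn.
Qed.

Lemma mpolyX_root h c a e : (0 < e)%N -> c != 0 -> h ^+ e = c *: 'X_[a] ->
  exists g b, [/\ h = g *: 'X_[b], g ^+ e = c & forall i, (e * b i)%N = a i].
Proof.
move=> e0 c0 eh.
(* With the weight that is 1 at [i] and 0 elsewhere, the exponent of y records the [i]-th
   coordinate. The substituted [h] is a monomial in y by [polyXn_root], so this coordinate is
   constant on the support, which is therefore a single point. *)
have same u v : u \in msupp h -> v \in msupp h -> u = v.
  move=> uh vh; apply/mnmP => i; pose k j := nat_of_bool (j == i).
  have dk w : mdot w k = w i.
    rewrite /mdot (bigD1 i) //= /k eqxx muln1 big1 ?addn0 // => j /negbTE ->.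
    by rewrite muln0.
  have cX0 : c *: 'X_[a] != 0 :> A.
    exact: mpolyZX_neq0.
  have eWe : weight_subst h k ^+ e = (c *: 'X_[a] : A) *: 'X^(a i).
    by rewrite -weight_substXn eh weight_subst_term dk.
  have [b [l eW]] := polyXn_root e0 cX0 eWe.
  have al w : w \in msupp h -> w i = l.
    rewrite mcoeff_msupp -(dk w); apply: contraNeq => /negbTE wl.
    have := coef_weight_subst h k (mdot w k) w.
    by rewrite eqxx mulr1n eW coefZ coefXn wl mulr0 mcoeff0 => <-.
  by rewrite !al.
have h0 : h != 0.
  apply: contra_neq c0 => h0; move: eh; rewrite h0 expr0n eqn0Ngt e0 /=.
  by move/(congr1 (mcoeff a)); rewrite mcoeff0 mcoeffZ mcoeffX eqxx mulr1 => <-.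
pose b := mlead h; have bh : b \in msupp h by exact: mlead_supp.
have ehb : h = h@_b *: 'X_[b].
  apply/mpolyP => v; rewrite mcoeffZ mcoeffX.
  case: eqP => [<-|bv]; rewrite ?mulr1 ?mulr0 //.
  by rewrite memN_msupp_eq0 //; apply/negP => /(same _ _ bh).
exists h@_b, b; move: eh; rewrite {1}ehb exprZn mpolyXn => eh.
have hb0 : h@_b ^+ e != 0 by rewrite expf_neq0 // -mcoeff_msupp.
have eab : (b *+ e)%MM = a.
  have := congr1 (mcoeff (b *+ e)) eh; rewrite !mcoeffZ !mcoeffX eqxx mulr1.
  by case: eqP => // _ /eqP; rewrite mulr0 (negbTE hb0).
split=> //; last by move=> i; rewrite -eab mulmnE mulnC.
have := congr1 (mcoeff a) eh; rewrite !mcoeffZ !mcoeffX eab eqxx !mulr1.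
by [].
Qed.

Lemma indeg_ge f u i : u \in msupp f -> (u i <= indeg f)%N.
Proof.
move=> uf; rewrite /indeg (big_rem u) //= leq_max; apply/orP; left.
exact: leq_bigmax.
Qed.

(* A minimizer [a] of the strictly concave function
   [\sum_i ((2d+2) u_i - u_i^2)] minimizes, uniquely, its linearization at
   [a], whose weights are [2d+2 - 2 a_i]. *)
Lemma weight_choice_exists f : f != 0 -> exists k a, weight_choice f k a.
Proof.
move=> f0; set d := indeg f.
pose phi (u : 'X_{1..n}) := (\sum_(i < n) (u i * (2 * d + 2 - u i)))%N.
have ex : exists v, has (fun u => phi u == v) (msupp f).
  by exists (phi (mlead f)); apply/hasP; exists (mlead f); rewrite ?mlead_supp.
case: (ex_minnP ex) => _ /hasP[a af /eqP <-] min.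
pose k (i : 'I_n) := (2 * d + 2 - 2 * a i)%N; exists k, a; split=> //.
  by move=> i; have := indeg_ge i af; rewrite -/d /k; lia.
move=> u uf una.
have le_phi : (phi a <= phi u)%N by apply: min; apply/hasP; exists u.
(* This is the squared distance from [u] to [a]: with truncated subtraction, one of the two squares
   always vanishes. It is the gap between the concave function and its linearization. *)
pose D := (\sum_(i < n) ((u i - a i) ^ 2 + (a i - u i) ^ 2))%N.
have D0 : (0 < D)%N.
  rewrite lt0n sum_nat_eq0; apply: contra una => /forallP /= D0.
  by apply/eqP/mnmP => i; have := D0 i; lia.
have : (phi a + mdot u k = phi u + mdot a k + D)%N.
  rewrite /phi /mdot /D -!big_split; apply: eq_bigr => i _ /=.
  have := indeg_ge i af; have := indeg_ge i uf; rewrite -/d /k.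
  nia.
lia.
Qed.

Section Leading.
Variables (f : A) (k : 'I_n -> nat) (a : 'X_{1..n}).
Hypothesis wc : weight_choice f k a.

Lemma lead_term_neq0 : lead_term f a != 0.
Proof.
have [_ af _] := wc.
by apply: mpolyZX_neq0; rewrite -mcoeff_msupp.
Qed.

Lemma Fsharp_uniq Fs Fs' :
  is_Fsharp f k a Fs -> is_Fsharp f k a Fs' -> Fs = Fs'.
Proof.
by rewrite /is_Fsharp => <- /(mulfI (monic_neq0 (monicXn _ _))).
Qed.

(** Minimality of [a] makes every coefficient below the exponent [mdot a k] vanish, so division by
    that power of y is exact. *)
Lemma Fsharp_exists : exists Fs, is_Fsharp f k a Fs.
Proof.
have [_ af min] := wc; exists (drop_poly (mdot a k) (weight_subst f k)).
apply/polyP => j; rewrite coefXnM coef_drop_poly.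
case: ltnP => ja; last by rewrite subnK.
apply/mpolyP => v; rewrite coef_weight_subst mcoeff0.
have [vf|vf] := boolP (v \in msupp f); last first.
  by rewrite (memN_msupp_eq0 vf) mul0rn.
case: eqP => // vj; have [va|/(min _ vf)] := eqVneq v a.
  by move: ja; rewrite -vj va ltnn.
by rewrite vj ltnNge (ltnW ja).
Qed.

Lemma Fsharp_at0 Fs : is_Fsharp f k a Fs -> Fs`_0 = lead_term f a.
Proof.
have [_ af min] := wc => eFs.
have := congr1 (fun P : {poly A} => P`_(mdot a k)) eFs.
rewrite coefXnM ltnn subnn => ->; apply/mpolyP => v.
rewrite coef_weight_subst mcoeffZ mcoeffX.
have [->|va] := eqVneq v a; first by rewrite !eqxx mulr1.
rewrite mulr0.
have [vf|vf] := boolP (v \in msupp f); last first.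
  by rewrite (memN_msupp_eq0 vf) mul0rn.
by rewrite gtn_eqF ?mulr0n // min.
Qed.

End Leading.

(** * Clearing the denominators of the Laurent expressions *)

Section Laurent.
Implicit Types (al B : A) (Fs H G R : {poly A}).

Lemma to_laurent_inj : injective (@to_laurent F n).
Proof.
apply: map_inj_poly (tofrac0 _) => x y /eqP.
by rewrite tofrac_eq => /eqP.
Qed.

Lemma is_HP al Fs H : al != 0 ->
  is_H al Fs H <-> forall j, al * H`_j = Fs`_j * al ^+ j.
Proof.
move=> al0; have tal0 : tofrac al != 0 by rewrite tofrac_eq0.
have coefE j : ((tofrac al)^-1 *: (to_laurent Fs \Po (tofrac al *: 'X)))`_j =
    (tofrac al)^-1 * tofrac (Fs`_j * al ^+ j).
  by rewrite coefZ coef_comp_polyZX coef_map rmorphM rmorphXn.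
split=> [eH j|eH].
  have := congr1 (fun P : {poly {fraction A}} => P`_j) eH.
  rewrite coefE coef_map /= => e; apply/eqP; rewrite -tofrac_eq rmorphM /= e.
  by rewrite mulVKf.
apply/polyP => j; rewrite coefE coef_map /= -eH rmorphM mulKf //.
Qed.

Lemma H_uniq al Fs H H' : is_H al Fs H -> is_H al Fs H' -> H = H'.
Proof. by rewrite /is_H => <- /to_laurent_inj. Qed.

Lemma H_exists al Fs : al != 0 -> Fs`_0 = al -> exists H, is_H al Fs H.
Proof.
move=> al0 Fs0.
(* The coefficient of y^j is F#_j alpha^(j-1), a polynomial for j > 0; for j = 0 it is alpha / alpha
   = 1. *)
exists (\poly_(j < size Fs) (if j is j'.+1 then Fs`_j * al ^+ j' else 1)).
apply/is_HP => // j; rewrite coef_poly.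
case: ltnP => [_|/(nth_default 0) ->]; last by rewrite mul0r mulr0.
by case: j => [|j]; rewrite ?Fs0 // exprS mulrCA.
Qed.

Lemma laurent_candidateE al B R G : al != 0 ->
  (forall j, B * R`_j = G`_j * al ^+ j) ->
  laurent_candidate al B R = to_laurent G.
Proof.
move=> al0 e; have tal0 : tofrac al != 0 by rewrite tofrac_eq0.
apply/polyP => j; rewrite coefZ coef_comp_polyZX !coef_map /=.
apply: (mulIf (expf_neq0 j tal0)).
by rewrite -!mulrA -exprMn mulVf // expr1n mulr1 -rmorphXn -!rmorphM e.
Qed.

End Laurent.
End WeightSubst.

(** * Runs of the procedure *)

Lemma polyXn_mul_inj (R : idomainType) m s (P Q : {poly R}) :
  P`_0 != 0 -> Q`_0 != 0 -> 'X^m * P = 'X^s * Q -> P = Q.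
Proof.
wlog ms : m s P Q / (m <= s)%N => [wl P0 Q0 e|P0 Q0 e].
  have [ms|/ltnW sm] := leqP m s; first exact: wl ms P0 Q0 e.
  by symmetry; apply: wl sm Q0 P0 (esym e).
have [ltms|] := ltnP m s; last first.
  move=> sm; have ems : m = s by lia.
  by move: e; rewrite ems => /(mulfI (monic_neq0 (monicXn _ _))).
have := congr1 (fun P : {poly R} => P`_m) e.
by rewrite !coefXnM ltnn ltms subnn => /eqP; rewrite (negbTE P0).
Qed.

Section FrobeniusStep.
Variables (F : fieldType) (n : nat).
Local Notation A := {mpoly F[n]}.
Implicit Types (H R : {poly A}) (out : option (nat * {poly A})).

Lemma frobenius_step_exists e H :
  (0 < e)%N -> exists out, frobenius_step e H out.
Proof.
move=> e0; have [[p [pF pe]]|no] :=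
    classic (exists p, p \in [pchar F] /\ (p %| e)%N); last first.
  exists (Some (e, H)); apply: Frobenius_skip => p pF.
  by apply/negP => pe; apply: no; exists p.
have [q pq eE] := pfactor_coprime (pcharf_prime pF) e0.
rewrite prime_coprime ?(pcharf_prime pF) // in pq; rewrite mulnC in eE.
have [t|t] := classic (term_test (p ^ logn p e) H); last first.
  by exists None; exact: Frobenius_fail pF pe eE pq t.
(* An arbitrary value is taken where no root exists; [term_test] ensures that this never happens at
   a coefficient of [H]. *)
pose rt c := epsilon (inhabits (0 : F)) (fun b => b ^+ (p ^ logn p e) = c).
exists (Some (q, term_root (p ^ logn p e) rt H)).
apply: (Frobenius_root pF pe eE pq t) => j u /t[_ _].
exact: epsilon_spec.
Qed.

(** A field has at most one positive characteristic, and [r] is the p-adic valuation of [e]. *)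
Lemma pchar_factorization_uniq e p r q p' r' q' :
  p \in [pchar F] -> p' \in [pchar F] -> (0 < e)%N ->
  e = (p ^ r * q)%N -> ~~ (p %| q)%N ->
  e = (p' ^ r' * q')%N -> ~~ (p' %| q')%N ->
  [/\ p = p', r = r' & q = q'].
Proof.
move=> pF p'F e0 eE pq eE' pq'.
have epp : p' = p by apply/eqP; rewrite -[_ == _](pcharf_eq pF).
subst p'; have pp := pcharf_prime pF.
have lr s t : ~~ (p %| t)%N -> e = (p ^ s * t)%N -> logn p e = s.
  move=> pt ->; rewrite mulnC logn_Gauss ?pfactorK //.
  by rewrite prime_coprime.
have err : r = r' by rewrite -(lr _ _ pq eE) -(lr _ _ pq' eE').
split=> //; apply/eqP; rewrite -(@eqn_pmul2l (p ^ r)) -?eE ?err -?eE' //.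
by rewrite expn_gt0 prime_gt0.
Qed.

Lemma frobenius_step_uniq e H out out' : (0 < e)%N ->
  frobenius_step e H out -> frobenius_step e H out' -> out = out'.
Proof.
move=> e0 [no|p r q rt pF pe eE pq t rtH|p r q pF pe eE pq t]
  [no'|p' r' q' rt' pF' pe' eE' pq' t' rtH'|p' r' q' pF' pe' eE' pq' t'] //.
- by have := no _ pF'; rewrite pe'.
- by have := no _ pF'; rewrite pe'.
- by have := no' _ pF; rewrite pe.
- have [ep er eq] := pchar_factorization_uniq pF pF' e0 eE pq eE' pq'.
  subst p' r' q'; congr (Some (_, _)).
  (* Whatever root functions are used, both results have p^r-th power [H]. *)
  apply: (@expr_pchar_inj _ _ r pF _ (polyC \o (@mpolyC n F))) => /=.
  by rewrite !term_root_pow.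
- have [ep er eq] := pchar_factorization_uniq pF pF' e0 eE pq eE' pq'.
  by subst p' r' q'; case: t'.
- by have := no' _ pF; rewrite pe.
- have [ep er eq] := pchar_factorization_uniq pF pF' e0 eE pq eE' pq'.
  by subst p' r' q'; case: t.
Qed.

(** Since R^e = (R^q)^(p^r), the term test cannot fail, and extracting the p^r-th root leaves
    R^q. *)
Lemma frobenius_step_exp e R out : (0 < e)%N -> frobenius_step e (R ^+ e) out ->
  exists q, [/\ out = Some (q, R ^+ q), q%:R != 0 :> F & (0 < q <= e)%N].
Proof.
move=> e0 [no|p r q rt pF pe eE pq t rtH|p r q pF pe eE pq t].
- exists e; rewrite e0 leqnn; split=> //; apply/negP => /eqP eF.
  have [|p pF] := @natf0_pchar F e e0; first exact/eqP.
  by have := no _ pF; rewrite (dvdn_pcharf pF) eF eqxx.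
- exists q; move: rtH t; rewrite {1 2 3 4}eE mulnC exprM => rtH t.
  have qF : q%:R != 0 :> F by rewrite -(dvdn_pcharf pF).
  have q0 : (0 < q)%N by rewrite lt0n; apply: contraNneq qF => ->.
  split=> //; last by rewrite q0 eE leq_pmull // (expr_pchar_gt0 _ pF).
  by rewrite {1}eE mulnC exprM term_root_exp.
- by case: t; rewrite eE mulnC exprM; exact: term_test_exp.
Qed.

End FrobeniusStep.

(** * From a root of f to roots of F# and H *)

Section Root.
Variables (F : fieldType) (n : nat).
Local Notation A := {mpoly F[n]}.
Variables (f : A) (e : nat) (k : 'I_n -> nat) (a : 'X_{1..n}) (Fs : {poly A}).
Hypotheses (e0 : (0 < e)%N) (wc : weight_choice f k a).
Hypothesis fFs : is_Fsharp f k a Fs.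

(** Take G to be the substituted [g] divided by its largest power of y. Then G^e and F# have nonzero
    constant terms and agree up to powers of y, hence are equal. *)
Lemma Fsharp_root g : f = g ^+ e ->
  exists G c b, [/\ G ^+ e = Fs, G`_0 = c *: 'X_[b], G.[1] = g,
    c ^+ e = f@_a & forall i, (e * b i)%N = a i].
Proof.
move=> fg; have al0 := lead_term_neq0 wc.
have fa0 : f@_a != 0 by have [_] := wc; rewrite mcoeff_msupp.
have W0 : weight_subst g k != 0.
  apply: contra_neq fa0 => W0; rewrite fg -(weight_subst_at1 g k) W0 horner0.
  by rewrite expr0n eqn0Ngt e0 mcoeff0.
have [m [G [eG G0]]] := factor_polyXn W0.
have GFs : G ^+ e = Fs.
  apply: (@polyXn_mul_inj _ (m * e) (mdot a k)).
  - by rewrite coef0_exp expf_neq0.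
  - by rewrite (Fsharp_at0 wc fFs).
  by rewrite fFs fg weight_substXn eG exprMn exprM.
have eG0 : G`_0 ^+ e = f@_a *: 'X_[a].
  by rewrite -coef0_exp GFs (Fsharp_at0 wc fFs).
have [c [b [Gb ec eb]]] := mpolyX_root e0 fa0 eG0.
exists G, c, b; split=> //.
by rewrite -(weight_subst_at1 g k) eG hornerM hornerXn expr1n mul1r.
Qed.

Lemma leading_test_exp g : f = g ^+ e -> leading_test f e a.
Proof.
move=> /Fsharp_root[G [c [b [_ _ _ ec eb]]]]; split; first by exists c.
by move=> i; rewrite -eb dvdn_mulr.
Qed.

(* Two [e]-th roots of the leading coefficient differ by an [e]-th root of
   unity, by which the root of [Fs] can be rescaled. *)
Lemma Fsharp_root_choice g beta b : f = g ^+ e -> root_choice f e a beta b ->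
  exists G, [/\ G ^+ e = Fs, G`_0 = beta *: 'X_[b] & G.[1] ^+ e = f].
Proof.
move=> fg [beta0 ebeta eb].
have [G [c [b' [GFs G0 G1 ec eb']]]] := Fsharp_root fg.
have c0 : c != 0.
  by apply: contra_neq beta0 => c0; apply/eqP; move/eqP: ebeta;
    rewrite -ec c0 !expr0n eqn0Ngt e0 expf_eq0 e0.
have -> : b = b'.
  apply/mnmP => i; apply/eqP; rewrite -(@eqn_pmul2l e) //.
  by rewrite eb eb'.
pose z := beta / c; have ze : z ^+ e = 1.
  by rewrite expr_div_n ebeta ec divff // -ec expf_neq0.
have zMe : z%:MP_[n] ^+ e = 1 :> A by rewrite -rmorphXn ze rmorph1.
exists ((z%:MP_[n])%:P * G); split.
- by rewrite exprMn GFs -rmorphXn zMe rmorph1 mul1r.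
- by rewrite coefCM G0 mul_mpolyC scalerA divfK.
- by rewrite hornerM hornerC exprMn zMe mul1r G1.
Qed.

Lemma H_root (B : A) (G H : {poly A}) :
  B ^+ e = lead_term f a -> G`_0 = B -> G ^+ e = Fs ->
  is_H (lead_term f a) Fs H ->
  exists R, [/\ R ^+ e = H, R`_0 = 1, (size R <= size G)%N
    & forall j, B * R`_j = G`_j * lead_term f a ^+ j].
Proof.
set al := lead_term f a => eB G0 GFs.
have al0 : al != 0 := lead_term_neq0 wc.
have B0 : B != 0 by apply: contra_neq al0 => B0; rewrite -eB B0 expr0n gtn_eqF.
move/(is_HP _ _ al0) => eH.
(* R_j is G_j alpha^j / B; because alpha = B^e, the quotient alpha / B is the polynomial B^(e-1). *)
pose R := \poly_(j < size G)
  (if j is j'.+1 then B ^+ e.-1 * al ^+ j' * G`_j else 1).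
have R0 : R`_0 = 1.
  rewrite coef_poly lt0n size_poly_eq0; case: eqP => // G00.
  by case/eqP: B0; rewrite -G0 G00 coef0.
have BR j : B * R`_j = G`_j * al ^+ j.
  case: j => [|j]; first by rewrite R0 G0 !mulr1.
  rewrite coef_poly; case: ltnP => [_|/(nth_default 0) ->]; last first.
    by rewrite mul0r mulr0.
  by rewrite !mulrA -exprS prednK // eB -exprS mulrC.
exists R; split=> //; last exact: size_poly.
(* Both [al%:P * H] and [B%:P * R] come from the substitution of alpha y for y, so the relation G^e
   = F# becomes (B R)^e = alpha H, and alpha = B^e cancels. *)
have comp_al : al%:P * H = Fs \Po (al *: 'X).
  by apply/polyP => j; rewrite coefCM coef_comp_polyZX eH.
have compB : B%:P * R = G \Po (al *: 'X).
  by apply/polyP => j; rewrite coefCM coef_comp_polyZX BR.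
have alP0 : al%:P != 0 by rewrite polyC_eq0.
apply: (mulfI alP0); rewrite comp_al -GFs.
rewrite (rmorphXn (comp_poly (al *: 'X))) /= -compB.
by rewrite exprMn -rmorphXn eB.
Qed.

End Root.

(** * Existence, uniqueness and correctness of the output *)

Section Outputs.
Variables (F : fieldType) (n : nat).
Variables (f : {mpoly F[n]}) (e : nat) (s : choices F n).
Local Notation A := {mpoly F[n]}.
Hypotheses (e0 : (0 < e)%N) (adm : admissible f e s).
Let wc : weight_choice f (ch_k s) (ch_a s) := proj1 adm.
Let al0 : lead_term f (ch_a s) != 0 := lead_term_neq0 wc.

Lemma reach_H_exists : leading_test f e (ch_a s) ->
  exists Fs H, reach_H f e s Fs H.
Proof.
move=> lt; have [Fs eFs] := Fsharp_exists wc.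
have [H eH] := H_exists al0 (Fsharp_at0 wc eFs).
by exists Fs, H.
Qed.

Lemma reach_H_uniq Fs H Fs' H' :
  reach_H f e s Fs H -> reach_H f e s Fs' H' -> Fs = Fs' /\ H = H'.
Proof.
move=> [_ eFs eH] [_ eFs' eH']; have eF := Fsharp_uniq eFs eFs'.
by subst Fs'; split=> //; exact: H_uniq eH eH'.
Qed.

Lemma reach_candidate_uniq L L' :
  reach_candidate f e s L -> reach_candidate f e s L' -> L = L'.
Proof.
move=> [Fs [H [q [H1 [rH fr ->]]]]] [Fs' [H' [q' [H1' [rH' fr' ->]]]]].
have [eF eH] := reach_H_uniq rH rH'; subst Fs' H'.
by have [-> ->] := frobenius_step_uniq e0 fr fr'.
Qed.

Lemma reach_candidate_frobenius L Fs H :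
  reach_candidate f e s L -> reach_H f e s Fs H ->
  ~ frobenius_step e H None.
Proof.
move=> [Fs' [H' [q [H1 [rH fr _]]]]] rH' fr'.
have [_ eH] := reach_H_uniq rH rH'; subst H'.
by have := frobenius_step_uniq e0 fr fr'.
Qed.

Lemma reach_candidate_leading L :
  reach_candidate f e s L -> leading_test f e (ch_a s).
Proof. by move=> [? [? [? [? [[]]]]]]. Qed.

Lemma outputs_exists : exists out, outputs f e s out.
Proof.
have [lt|lt] := classic (leading_test f e (ch_a s)); last first.
  by exists None; exact: Stop_leading.
have [Fs [H rH]] := reach_H_exists lt.
have [[[q H']|] fr] := frobenius_step_exists H e0; last first.
  by exists None; exact: Stop_frobenius rH fr.
set L := laurent_candidate (lead_term f (ch_a s))
  (ch_beta s *: 'X_[ch_b s]) (root_series q Fs H').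
have rL : reach_candidate f e s L by exists Fs, H, q, H'.
have [pL|pL] := classic (is_polynomial L); last first.
  by exists None; exact: Stop_laurent rL pL.
have [[g [gL gf]]|ng] := classic (exists g, tofrac g = L.[1] /\ g ^+ e = f).
  by exists (Some g); exact: Return rL pL gL gf.
by exists None; exact: Stop_power rL pL ng.
Qed.

Lemma outputs_uniq out out' :
  outputs f e s out -> outputs f e s out' -> out = out'.
Proof.
(* It suffices to compare a successful run with any other: each stopping rule contradicts the
   uniqueness of the intermediate data, and two [None] answers agree trivially. *)
have excl g out1 :
    outputs f e s (Some g) -> outputs f e s out1 -> out1 = Some g.
  move E: (Some g) => o1 h; case: h E => // L g0 rL pL gL gf [eg]; subst g0.
  move=> [nl|Fs H rH fr|L' rL' npL|L' rL' _ ng|L' g' rL' _ gL' _].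
  - by have := reach_candidate_leading rL.
  - by have := reach_candidate_frobenius rL rH.
  - by case: npL; rewrite (reach_candidate_uniq rL' rL).
  - by case: ng; exists g; rewrite (reach_candidate_uniq rL' rL).
  - congr Some; apply/eqP; rewrite -tofrac_eq gL gL'.
    by rewrite (reach_candidate_uniq rL' rL).
case: out out' => [g|] [g'|] // o o'; first by rewrite (excl _ _ o o').
  by rewrite (excl _ _ o o').
by rewrite (excl _ _ o' o).
Qed.

Lemma outputs_root g : f = g ^+ e -> exists g', outputs f e s (Some g').
Proof.
move=> fg; have [_ adm2] := adm.
have [Fs0 fFs0] := Fsharp_exists wc.
have lt := leading_test_exp e0 wc fFs0 fg.
have rc := adm2 lt; have [beta0 ebeta eb] := rc.
have [Fs [H rH]] := reach_H_exists lt; have [_ fFs eH] := rH.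
have [G [GFs G0 G1]] := Fsharp_root_choice e0 wc fFs fg rc.
set B : A := _ *: _ in G0.
have eB : B ^+ e = lead_term f (ch_a s).
  rewrite exprZn mpolyXn ebeta; congr (_ *: 'X_[_]); apply/mnmP => i.
  by rewrite mulmnE mulnC eb.
have [R [RH R0 sR BR]] := H_root e0 wc eB G0 GFs eH.
have [out fr] := frobenius_step_exists H e0.
have [|q [eout qF /andP[q0 qe]]] := @frobenius_step_exp _ _ e R out e0.
  by rewrite RH.
subst out.
have eL : laurent_candidate (lead_term f (ch_a s)) B (root_series q Fs (R ^+ q))
    = to_laurent G.
  rewrite root_series_exact //; first exact: laurent_candidateE.
  (* The truncation order suffices: in y, deg R <= deg G = deg F# / e <= deg F# / q, because q <=
     e. *)
  rewrite (leq_trans sR) // -GFs size_exp (leq_trans (leqSpred _)) // ltnS.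
  by rewrite leq_divRL // leq_mul.
exists G.[1]; apply: (@Return _ _ _ _ _ (to_laurent G)) => //.
- by exists Fs, H, q, (R ^+ q).
- by exists G.
- by rewrite -(tofrac1 A) horner_map.
Qed.

End Outputs.

Theorem proposition5p1 (F : fieldType) (n : nat) (f : {mpoly F[n]}) (e : nat)
    (f_nonconst : ~ (exists c : F, f = c%:MP_[n])) (e_ge2 : (2 <= e)%N) :
  (exists s : choices F n, admissible f e s) /\
  (forall s : choices F n, admissible f e s ->
    (exists! out : option {mpoly F[n]}, outputs f e s out) /\
    (forall out : option {mpoly F[n]}, outputs f e s out ->
      ((exists g : {mpoly F[n]}, f = g ^+ e) ->
         exists g' : {mpoly F[n]}, out = Some g' /\ g' ^+ e = f) /\
      (~ (exists g : {mpoly F[n]}, f = g ^+ e) -> out = None))).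
Proof.
have e0 : (0 < e)%N by apply: leq_trans e_ge2.
have f0 : f != 0.
  by apply/eqP => f0; apply: f_nonconst; exists 0; rewrite mpolyC0.
split.
  have [k [a wc]] := weight_choice_exists f0.
  have [[[beta ebeta] ea]|nl] := classic (leading_test f e a); last first.
    (* The procedure stops at the leading test, so the last two fields are arbitrary. *)
    by exists (Choices k a 0 a).
  exists (Choices k a beta (mnm_div a e)); split=> // _; split=> //=.
    have [_ + _] := wc; rewrite mcoeff_msupp -ebeta.
    by rewrite expf_eq0 e0.
  by move=> i; rewrite mnmE mulnC divnK.
move=> s adm; have uniq := @outputs_uniq _ _ f e s e0; split.
  have [out o] := outputs_exists e0 adm.
  by exists out; split=> // out'; exact: uniq.
move=> out o; split=> [[g fg]|ng].
  have [g' o'] := outputs_root e0 adm fg; rewrite (uniq _ _ o o'); exists g'.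
  by split=> //; inversion o'.
by case: o => // L g _ _ _ gf; case: ng; exists g.
Qed.
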